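(* Let $m$ be a positive integer and $q=2^m$. Then $$f(x)=x+x^{q^2+2}+x^{2q+1}+x^{3}+x^{3q}$$ is a permutation polynomial over $\mathbb{F}_{q^3}$ if and only if $m$ is odd.
   Context: $\mathbb{F}_{q^3}$ denotes the finite field with $q^3$ elements. A polynomial $f\in\mathbb{F}_{q^3}[x]$ is a permutation polynomial over $\mathbb{F}_{q^3}$ if the associated map $c\mapsto f(c)$ from $\mathbb{F}_{q^3}$ to itself is a bijection. *)

(* Defs.v *)
From mathcomp Require Import all_boot all_order all_algebra all_field.

Set Implicit Arguments.
Unset Strict Implicit.
Unset Printing Implicit Defensive.

Import GRing.Theory.
Local Open Scope ring_scope.

Definition permutation_poly (F : finFieldType) (f : {poly F}) : Prop :=
  bijective (fun c : F => f.[c]).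

(* Main.v *)
Require Import Defs.
From mathcomp Require Import all_boot all_order all_algebra all_field.
From mathcomp Require Import ring zify.

(** Write [y = x^q], [z = x^(q^2)], so that [f x = conj_form x y z], and let
[Tr] be the trace to [F_q].  In characteristic 2, [Tr (f x) = Tr x]; hence
[f (x + a) = f x] forces [Tr a = 0], i.e. [c = a + b] with [b = a^q] and
[c = a^(q^2)].  For such [a], [f (x + a) - f x = P + P^q] for some [P]; when
[1, b, c] is a basis of [F] over [F_q], [P] lies in [F_q] only if
[gamma^2 + gamma + 1 = 0], where [gamma] is the coordinate of [x] along [c].
Clearing the denominator [e = b^2 + b c + c^2] of Cramer's rule turns this into
a polynomial identity yielding [g^2 + g e + e^2 = 0].  If [m] is odd, [F] has
no primitive cube root of unity, so [e = 0], then [b = 0], then [a = 0].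
If [m] is even, take [a <> 0] with [a^(q-1)] a primitive cube root of unity:
then [f (1 + a) = f 1]. *)

Set Implicit Arguments.
Unset Strict Implicit.
Unset Printing Implicit Defensive.

Import GRing.Theory.
Local Open Scope ring_scope.

Definition conj_form (R : pzRingType) (x y z : R) : R :=
  x + z * x ^+ 2 + y ^+ 2 * x + x ^+ 3 + y ^+ 3.

Section Char2.
Variables (R : comNzRingType) (char2 : 2%:R = 0 :> R).

Lemma natr_mul2 n : (2 * n)%:R = 0 :> R.
Proof. by rewrite natrM char2 mul0r. Qed.

Lemma addr_eq0_char2 (u v : R) : u + v = 0 <-> u = v.
Proof.
split=> [uv0 | ->]; last by ring: char2.
have -> : u = (u + v) + v by ring: char2.
by rewrite uv0 add0r.
Qed.

Lemma conj_form_trace (x y z : R) :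
  conj_form x y z + conj_form y z x + conj_form z x y = x + y + z.
Proof. rewrite /conj_form; ring: char2. Qed.

(** For [x = alpha + beta b + gamma c] with coordinates in [F_q], Frobenius gives
    [y + z = beta b + gamma c] and [z + x = beta c + gamma a]; hence [g = gamma e]. *)
Lemma conj_form_cramer (a b x y z : R) (c := a + b)
    (e := b ^+ 2 + b * c + c ^+ 2) (g := b * (z + x) + c * (y + z)) :
  b * (conj_form (x + a) (y + b) (z + c) + conj_form x y z)
    + a * (conj_form (y + b) (z + c) (x + a) + conj_form y z x)
  = g ^+ 2 + g * e + e ^+ 2.
Proof.
apply/addr_eq0_char2; rewrite /conj_form /g /e /c.
(* [ring] rewrites a coefficient only when it equals a given one; these are
   all the even coefficients occurring in the expansion. *)
ring: (natr_mul2 1%N) (natr_mul2 2%N) (natr_mul2 3%N)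
  (natr_mul2 4%N) (natr_mul2 5%N) (natr_mul2 6%N)
  (natr_mul2 7%N) (natr_mul2 11%N).
Qed.

(** Used with [w = a^(q-1)] fixed by Frobenius: the arguments on the left are then [1 + a] and its
    conjugates. *)
Lemma conj_form_cube_root (w a : R) :
  w ^+ 2 + w + 1 = 0 ->
  conj_form (1 + a) (1 + w * a) (1 + w ^+ 2 * a) = conj_form 1 1 1.
Proof.
move=> w0; have w2 : w ^+ 2 = w + 1.
  by apply/addr_eq0_char2; rewrite addrA.
apply/addr_eq0_char2; rewrite /conj_form.
ring: w2 (natr_mul2 1%N) (natr_mul2 2%N) (natr_mul2 3%N) (natr_mul2 4%N)
  (natr_mul2 5%N) (natr_mul2 6%N).
Qed.

End Char2.

Lemma expn2_odd_mod3 n : odd n -> (2 ^ n = 2 %[mod 3])%N.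
Proof.
move=> n_odd; rewrite -(odd_double_half n) n_odd -mul2n expnD expnM.
by rewrite -modnMmr -modnXm exp1n.
Qed.

Lemma expn2_even_mod3 n : ~~ odd n -> (2 ^ n = 1 %[mod 3])%N.
Proof.
move=> n_even; rewrite -(odd_double_half n) (negbTE n_even) -mul2n expnM.
by rewrite -modnXm exp1n.
Qed.

Section OddDegree.
Variables (F : finFieldType) (n : nat).
Hypotheses (cardF : #|F| = (2 ^ n)%N) (n_odd : odd n).

Lemma quad_form_anisotropic (u v : F) :
  u ^+ 2 + u * v + v ^+ 2 = 0 -> u = 0 /\ v = 0.
Proof.
wlog suff v0 : u v / u ^+ 2 + u * v + v ^+ 2 = 0 -> v = 0.
  move=> uv0; split; last exact: v0 uv0.
  by apply: (v0 v u); rewrite -uv0; ring.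
move=> uv0; apply/eqP/negPn/negP => v_neq0.
pose t := u / v.
have t0 : t ^+ 2 + t + 1 = 0.
  have -> : t ^+ 2 + t + 1 = (u ^+ 2 + u * v + v ^+ 2) / v ^+ 2.
    by rewrite /t; field.
  by rewrite uv0 mul0r.
have t3 : t ^+ 3 = 1.
  apply/eqP; rewrite -subr_eq0; apply/eqP.
  by transitivity ((t - 1) * (t ^+ 2 + t + 1)); [ring | rewrite t0 mulr0].
(* [|F|] is 2 modulo 3, so [t^3 = 1] gives [t = t^|F| = t^2]. *)
have tt : t ^+ 2 = t.
  rewrite -[RHS]expf_card cardF (divn_eq (2 ^ n) 3) expn2_odd_mod3 //.
  by rewrite exprD mulnC exprM t3 expr1n mul1r.
have pF : 2 \in [pchar F] by apply: card_finPcharP cardF _.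
move: t0; rewrite tt (addrr_pchar2 pF) add0r => /eqP.
by rewrite oner_eq0.
Qed.

End OddDegree.

(** [X^N - 1] has at most [N] roots, too few to cover all nonzero elements. *)
Lemma exists_expf_neq1 (F : finFieldType) (N : nat) :
  (0 < N)%N -> (N < #|F|.-1)%N -> exists2 v : F, v != 0 & v ^+ N != 1.
Proof.
move=> N_gt0 ltN.
have [/existsP[v /andP[v0 v1]] | /existsPn all1] :=
  boolP [exists v : F, (v != 0) && (v ^+ N != 1)]; first by exists v.
pose rs := enum (predC1 (0 : F)).
have := @max_poly_roots F ('X^N - 1%:P) rs.
rewrite size_XnsubC // -size_poly_eq0 size_XnsubC // enum_uniq.
move/(_ isT) => H.
have /H/(_ isT) : all (root ('X^N - 1%:P)) rs.
  apply/allP => v; rewrite mem_enum inE => v0.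
  by have := all1 v; rewrite v0 /= negbK => /eqP v1;
    rewrite rootE !hornerE v1 subrr.
by rewrite -cardE cardC1 ltnS leqNgt ltN.
Qed.

Section Frobenius.
Variables (F : finFieldType) (m q : nat).
Hypotheses (m_gt0 : (0 < m)%N) (q_def : q = (2 ^ m)%N).
Hypothesis cardF : #|F| = (q ^ 3)%N.

Let cardF2 : #|F| = (2 ^ (m * 3))%N.
Proof. by rewrite cardF q_def expnM. Qed.

Let pcharF : 2 \in [pchar F].
Proof. exact: card_finPcharP cardF2 _. Qed.

Let char2 : 2%:R = 0 :> F.
Proof. exact: pcharf0. Qed.

Let frobD (x y : F) : (x + y) ^+ q = x ^+ q + y ^+ q.
Proof.
by apply: exprDn_pchar; rewrite q_def pnatX; apply/orP; left; rewrite pnatE.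
Qed.

Let frob3 (x : F) : ((x ^+ q) ^+ q) ^+ q = x.
Proof. by rewrite -!exprM -[RHS]expf_card cardF !expnS expn0 muln1 mulnA. Qed.

Lemma horner_conj_form (x : F) :
  ('X + 'X^(q ^ 2 + 2) + 'X^(2 * q + 1) + 'X^3 + 'X^(3 * q)).[x]
  = conj_form x (x ^+ q) ((x ^+ q) ^+ q).
Proof.
rewrite !hornerE /conj_form; congr (_ + _ + _ + _ + _).
- by rewrite exprD -mulnn exprM.
- by rewrite mulnC exprD exprM expr1.
- by rewrite mulnC exprM.
Qed.

Lemma frob_conj_form (x y z : F) :
  conj_form x y z ^+ q = conj_form (x ^+ q) (y ^+ q) (z ^+ q).
Proof. by rewrite /conj_form !(frobD, exprMn). Qed.

Lemma conj_form_inj : odd m ->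
  injective (fun x : F => conj_form x (x ^+ q) ((x ^+ q) ^+ q)).
Proof.
move=> m_odd x' x E1.
have n_odd : odd (m * 3) by rewrite oddM m_odd.
pose a := x' + x; have x'E : x' = x + a by rewrite /a; ring: char2.
clearbody a; subst x'.
move: E1; rewrite /= !frobD.
set b := a ^+ q; set c := b ^+ q; set y := x ^+ q; set z := y ^+ q => E1.
(* Frobenius permutes [x, y, z] and [a, b, c] cyclically, so [E1] yields its two conjugates. *)
have E2 := congr1 (fun t => t ^+ q) E1.
rewrite !frob_conj_form !frobD !frob3 -/y -/z -/b -/c in E2.
have E3 := congr1 (fun t => t ^+ q) E2.
rewrite !frob_conj_form !frobD !frob3 -/y -/z -/b -/c in E3.
have cE : c = a + b.
  have := conj_form_trace char2 (x + a) (y + b) (z + c).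
  rewrite E1 E2 E3 (conj_form_trace char2) => T.
  apply/(addr_eq0_char2 char2)/(addrI (x + y + z)).
  by rewrite addr0 [RHS]T; ring.
have := conj_form_cramer char2 a b x y z.
rewrite /= -cE E1 E2 !addrr_pchar2 // !mulr0 addr0 => /esym.
(* This gives [e = 0]; as [e] is the same quadratic form in [b] and [c], anisotropy applies
   again. *)
case/(quad_form_anisotropic cardF2 n_odd) => _.
case/(quad_form_anisotropic cardF2 n_odd) => b0 _.
have -> : a = 0 by apply/eqP; move/eqP: b0; rewrite expf_eq0 => /andP[].
by rewrite addr0.
Qed.

Lemma conj_form_collision : ~~ odd m ->
  ~ injective (fun x : F => conj_form x (x ^+ q) ((x ^+ q) ^+ q)).
Proof.
move=> m_even injf.
pose j := (q %/ 3)%N; have qE : q = (3 * j + 1)%N.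
  by rewrite /j {1}(divn_eq q 3) q_def expn2_even_mod3 // mulnC.
have j_gt0 : (0 < j)%N.
  rewrite /j divn_gt0 // q_def; case: m m_gt0 m_even => [|[|k]] // _ _.
  by rewrite !expnS; have := expn_gt0 2 k; lia.
(* Here [k = (q^2 + q + 1) / 3] and [3 j = q - 1], so [3 j k = (|F| - 1) / 3]. For [a = v^k], the
   ratio [a^(q-1)] is thus a cube root of unity, and [v] is chosen to make it differ from 1. *)
pose k := (3 * j ^ 2 + 3 * j + 1)%N.
have cardE : (q ^ 3)%N = (3 * j * k * 3 + 1)%N.
  by rewrite qE /k !expnS !expn0; ring.
have [v v0 vN] : exists2 v : F, v != 0 & v ^+ (3 * j * k) != 1.
  by apply: exists_expf_neq1; rewrite ?cardF ?cardE /k; nia.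
pose a := v ^+ k; pose w := v ^+ (3 * j * k).
have w3 : w ^+ 3 = 1.
  apply: (mulIf v0); rewrite mul1r -[RHS]expf_card cardF cardE.
  by rewrite exprD expr1 exprM.
have w0 : w ^+ 2 + w + 1 = 0.
  have : (w - 1) * (w ^+ 2 + w + 1) = 0.
    by transitivity (w ^+ 3 - 1); [ring | rewrite w3 subrr].
  by move/eqP; rewrite mulf_eq0 subr_eq0 (negPf vN) => /eqP.
have aq : a ^+ q = w * a.
  by rewrite qE exprD expr1 /a /w -exprM (mulnC k).
have wq : w ^+ q = w by rewrite qE exprD exprM w3 expr1n mul1r.
have := @injf (1 + a) 1; rewrite /= !(frobD, expr1n, aq, exprMn, wq) mulrA.
rewrite conj_form_cube_root // => /(_ erefl)/eqP.
rewrite -subr_eq0 addrC addKr => /eqP a0.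
by have := expf_neq0 k v0; rewrite -/a a0 eqxx.
Qed.

End Frobenius.

Theorem theorem3p3 (m q : nat) (m_gt0 : (0 < m)%N) (q_def : q = (2 ^ m)%N)
    (F : finFieldType) (cardF : #|F| = (q ^ 3)%N) :
  permutation_poly
    ('X + 'X^(q ^ 2 + 2) + 'X^(2 * q + 1) + 'X^3 + 'X^(3 * q) : {poly F})
  <-> odd m.
Proof.
split=> [/bij_inj injf | m_odd].
  apply/negPn/negP => /(conj_form_collision m_gt0 q_def cardF); apply.
  by move=> x y; rewrite -!horner_conj_form; apply: injf.
apply: injF_bij => x y; rewrite !horner_conj_form.
exact: conj_form_inj q_def cardF m_odd _ _.
Qed.
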